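(* There exist an integer $N\ge1$ and real parameters $x_1,\ldots,x_N,y_1,\ldots,y_N,\beta$ satisfying $x_i,y_j\ge0$, $x_iy_j<1$ for all $i,j$, and $\beta\le\min_{1\le i\le N}(x_i^{-1},y_i)$, such that the correlation functions $\rho(a_1,\ldots,a_m)$ of the Grothendieck measure with these parameters do not have a determinantal form. That is, there does not exist a function $K\colon\mathbb{Z}_{\ge0}\times\mathbb{Z}_{\ge0}\to\mathbb{C}$ such that $\rho(a_1,\ldots,a_m)=\det[K(a_i,a_j)]_{i,j=1}^m$ for all $m\ge1$ and all pairwise distinct $a_1,\ldots,a_m\in\mathbb{Z}_{\ge0}$.
   Context: For a partition $\lambda=(\lambda_1\ge\cdots\ge\lambda_N\ge0)$ (integer parts) define the symmetric polynomials $$G_\lambda(x_1,\ldots,x_N)=\frac{\det\bigl[x_i^{\lambda_j+N-j}(1-\beta x_i)^{j-1}\bigr]_{i,j=1}^N}{\prod_{1\le i<j\le N}(x_i-x_j)},\qquad \overline G_\lambda(y_1,\ldots,y_N)=\frac{\det\bigl[y_i^{\lambda_j+N-j}(1-\beta y_i^{-1})^{N-j}\bigr]_{i,j=1}^N}{\prod_{1\le i<j\le N}(y_i-y_j)}.$$ Both are polynomials in their variables, so they can be evaluated when some of the variables coincide or vanish. The Grothendieck measure with parameters $x_i,y_j,\beta$ is the probability measure on partitions $\lambda$ with at most $N$ parts given by $$\mathrm{Prob}(\lambda)=\frac{1}{Z'}\,G_\lambda(x_1,\ldots,x_N)\,\overline G_\lambda(y_1,\ldots,y_N),\qquad Z'=\prod_{i=1}^N(1-x_i\beta)^{N-1}\prod_{i,j=1}^N(1-x_iy_j)^{-1}.$$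 Its correlation functions are, for pairwise distinct $a_1,\ldots,a_m\in\mathbb{Z}_{\ge0}$, $$\rho(a_1,\ldots,a_m)=\mathrm{Prob}\bigl(\text{the random set }\{\lambda_i+N-i:1\le i\le N\}\subset\mathbb{Z}_{\ge0}\text{ contains each of }a_1,\ldots,a_m\bigr).$$ If $x_i=0$, then $x_i^{-1}$ is understood as $+\infty$. *)

(* Defs.v *)
From HB Require Import structures.
From mathcomp Require Import all_boot all_order all_algebra.
From mathcomp Require Import boolp classical_sets reals ereal measure.
From mathcomp Require Import -(notations) mpoly.
From mathcomp Require Import complex.
Set Implicit Arguments.
Unset Strict Implicit.
Unset Printing Implicit Defensive.
Import Order.TTheory GRing.Theory Num.Theory.
Local Open Scope classical_set_scope.
Local Open Scope ring_scope.

(* The notations of mpoly clash with those of MathComp-Analysis; these stand for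
   {mpoly R[n]}, 'X_i, c%:MP and p.@[v]. *)
Notation mpol R n := (mpoly.mpoly n R).
Notation mvar R i := (mpoly.mpolyX R (mpoly.mnm1 i)).
Notation mcst n c := (mpoly.mpolyC n c).
Notation mev v p := (mpoly.meval v p).

Definition intpart (N : nat) : Type := {l : N.-tuple nat | sorted geq l}.

Lemma sorted_nseq0 (N : nat) : sorted geq [tuple of nseq N 0%N].
Proof. by case: N => //=; elim=> [|n IHn] //=. Qed.

HB.instance Definition _ (N : nat) :=
  Countable.copy (intpart N) {l : N.-tuple nat | sorted geq l}.
HB.instance Definition _ (N : nat) :=
  isPointed.Build (intpart N) (exist _ [tuple of nseq N 0%N] (sorted_nseq0 N)).
HB.instance Definition _ (N : nat) :=
  @isMeasurable.Build default_measure_display (intpart N) discrete_measurable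
    discrete_measurable0 discrete_measurableC discrete_measurableU.

(* Indices run over 0, ..., N-1: the part lambda_(j+1) is part l j, and the
   exponents N - (j+1) and (j+1) - 1 are (N - j.+1)%N and j. *)
Definition part (N : nat) (l : intpart N) (j : 'I_N) : nat := tnth (val l) j.

Definition particle (N : nat) (l : intpart N) (j : 'I_N) : nat :=
  (part l j + (N - j.+1))%N.

Definition vdm (A : comNzRingType) (N : nat) (x : 'I_N -> A) : A :=
  \prod_(i < N) \prod_(j < N | (i < j)%N) (x i - x j).

Definition G_ratio (F : fieldType) (N : nat) (b : F) (l : intpart N)
    (x : 'I_N -> F) : F :=
  \det (\matrix_(i < N, j < N) (x i ^+ particle l j * (1 - b * x i) ^+ j))
  / vdm x.

Definition Gbar_ratio (F : fieldType) (N : nat) (b : F) (l : intpart N)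
    (y : 'I_N -> F) : F :=
  \det (\matrix_(i < N, j < N)
          (y i ^+ particle l j * (1 - b * (y i)^-1) ^+ (N - j.+1)))
  / vdm y.

(* The symmetric polynomials are the elements of R[x_1, ..., x_N] which equal
   these ratios, taken at the indeterminates, in the field R(x_1, ..., x_N)
   (see G_polyP and Gbar_polyP). Evaluating them makes sense also at points
   with coinciding or zero coordinates. *)
Definition G_poly (R : idomainType) (N : nat) (beta : R) (l : intpart N) :
    mpol R N :=
  xget 0 [set p : mpol R N | tofrac p =
    G_ratio (tofrac (mcst N beta)) l (fun i => tofrac (mvar R i))].

Definition Gbar_poly (R : idomainType) (N : nat) (beta : R) (l : intpart N) :
    mpol R N :=
  xget 0 [set p : mpol R N | tofrac p =
    Gbar_ratio (tofrac (mcst N beta)) l (fun i => tofrac (mvar R i))].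

Definition G (R : idomainType) (N : nat) (beta : R) (l : intpart N)
    (x : 'I_N -> R) : R := mev x (G_poly beta l).

Definition Gbar (R : idomainType) (N : nat) (beta : R) (l : intpart N)
    (y : 'I_N -> R) : R := mev y (Gbar_poly beta l).

Definition Gnorm (R : fieldType) (N : nat) (x y : 'I_N -> R) (beta : R) : R :=
  (\prod_(i < N) (1 - x i * beta) ^+ N.-1) *
  \prod_(i < N) \prod_(j < N) (1 - x i * y j)^-1.

Definition Gweight (R : fieldType) (N : nat) (x y : 'I_N -> R) (beta : R)
    (l : intpart N) : R :=
  (Gnorm x y beta)^-1 * G beta l x * Gbar beta l y.

(* The sigma-algebra on the countable type intpart N is discrete, so a measure
   is determined by its atoms. *)
Definition is_Grothendieck_measure (R : realType) (N : nat) (x y : 'I_N -> R)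
    (beta : R) (P : probability (intpart N) R) : Prop :=
  forall l : intpart N, P [set l] = (Gweight x y beta l)%:E.

Definition corr (R : realType) (N : nat) (P : probability (intpart N) R)
    (m : nat) (a : 'I_m -> nat) : R :=
  fine (P [set l | forall k : 'I_m, exists i : 'I_N, particle l i = a k]).

Definition determinantal (R : realType)
    (rho : forall m : nat, ('I_m -> nat) -> R) : Prop :=
  exists K : nat -> nat -> R[i],
    forall (m : nat) (a : 'I_m -> nat), (0 < m)%N -> injective a ->
      ((rho m a)%:C)%C = \det (\matrix_(i < m, j < m) K (a i) (a j)).

Lemma vdm_dvd_det (A : comNzRingType) (N : nat) (f : 'I_N -> {poly A})
    (x : 'I_N -> A) :
  exists p, \det (\matrix_(i < N, j < N) (f j).[x i]) = p * vdm x.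
Proof.
elim: N f x => [|N IH] f x.
  by exists 1; rewrite mul1r /vdm big_ord0 det_mx00.
have dq (j : 'I_N.+1) : exists q, f j - (f j).[x ord0]%:P = q * ('X - (x ord0)%:P).
  by apply/factor_theorem; rewrite /root !hornerE subrr.
have [q Hq] := choice dq.
pose r i : A := if i == ord0 then 1 else x ord0 - x i.
pose B := \matrix_(i < N.+1, j < N.+1)
   (if i == ord0 then (f j).[x ord0] else - (q j).[x i]).
pose L := \matrix_(i < N.+1, j < N.+1)
   (if i == j then r i else (j == ord0)%:R).
have -> : \matrix_(i < N.+1, j < N.+1) (f j).[x i] = L *m B.
  apply/matrixP=> i j; rewrite !mxE.
  have [->|i0] := eqVneq i ord0.
    rewrite (bigD1 ord0) //= !mxE !eqxx /r eqxx mul1r big1 ?addr0 // => k k0.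
    by rewrite !mxE eq_sym (negPf k0) mul0r.
  rewrite (bigD1 ord0) //= (bigD1 i) //= !mxE !eqxx (negPf i0) mul1r.
  rewrite big1 ?addr0 => [|k /andP[k0 ki]]; last first.
    by rewrite !mxE eq_sym (negPf ki) (negPf k0) mul0r.
  have /(congr1 (fun p => p.[x i])) := Hq j.
  rewrite /r (negPf i0) !hornerE => /eqP; rewrite subr_eq => /eqP ->.
  by rewrite mulrN -mulNr opprB addrC mulrC.
rewrite det_mulmx det_trig; last first.
  apply/is_trig_mxP => i j ij; rewrite mxE.
  have -> : (i == j) = false by apply/negbTE; rewrite neq_ltn ij.
  by have -> : (j == ord0) = false by apply/negbTE; rewrite -val_eqE -lt0n (leq_ltn_trans _ ij).
have [p Hp] : exists p, \det B = p * vdm (fun i => x (lift ord0 i)).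
  rewrite (expand_det_row _ ord0).
  have Hc j : exists p, B ord0 j * cofactor B ord0 j
                        = p * vdm (fun i => x (lift ord0 i)).
    have [p Hp] := IH (fun k => - q (lift j k)) (fun i => x (lift ord0 i)).
    exists (B ord0 j * ((-1) ^+ (0 + j)%N * p)).
    rewrite -!mulrA -Hp /cofactor; congr (_ * (_ * \det _)).
    apply/matrixP=> i k; rewrite !mxE hornerN.
    by rewrite (_ : lift ord0 i == ord0 = false) // eq_sym; apply/negbTE/neq_lift.
  have [p Hp] := choice Hc.
  by exists (\sum_j p j); rewrite mulr_suml; apply: eq_bigr.
exists p; rewrite Hp mulrCA; congr (_ * _).
rewrite /vdm [RHS]big_ord_recl; congr (_ * _).
  rewrite big_ord_recl mxE eqxx /r eqxx mul1r.
  rewrite [RHS]big_mkcond [RHS]big_ord_recl /= mul1r; apply: eq_bigr => i _.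
  by rewrite mxE eqxx /r eq_sym (negPf (neq_lift _ _)).
apply: eq_bigr => i _; rewrite [RHS]big_mkcond [RHS]big_ord_recl /= mul1r.
by rewrite [LHS]big_mkcond.
Qed.

Lemma vdm_mvar_neq0 (R : idomainType) (N : nat) :
  vdm (fun i : 'I_N => mvar R i) != 0.
Proof.
apply/prodf_neq0 => i _; apply/prodf_neq0 => j ij.
rewrite subr_eq0; apply/eqP => /(congr1 (mpoly.mcoeff (mpoly.mnm1 i))).
rewrite !mpoly.mcoeffX eqxx.
rewrite mpoly.eq_mnm1 -val_eqE gtn_eqF //=.
by move/eqP; rewrite oner_eq0.
Qed.

Lemma tofrac_vdm (R : idomainType) (N : nat) (x : 'I_N -> R) :
  vdm (fun i => tofrac (x i)) = tofrac (vdm x).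
Proof.
rewrite /vdm rmorph_prod; apply: eq_bigr => i _.
by rewrite rmorph_prod; apply: eq_bigr => j _; rewrite rmorphB.
Qed.

Lemma G_polyP (R : idomainType) (N : nat) (beta : R) (l : intpart N) :
  tofrac (G_poly beta l) =
  G_ratio (tofrac (mcst N beta)) l (fun i => tofrac (mvar R i)).
Proof.
apply: (@xgetPex _ _ [set p : mpol R N | tofrac p = _]).
have [p Hp] := vdm_dvd_det
  (fun j => 'X^(particle l j) * (1 - (mcst N beta)%:P * 'X) ^+ (j : nat))
  (fun i => mvar R i).
exists p; rewrite /= /G_ratio tofrac_vdm.
apply: (canRL (mulfK _)); first by rewrite tofrac_eq0 vdm_mvar_neq0.
rewrite -rmorphM -Hp -det_map_mx; congr (\det _).
apply/matrixP => i j; rewrite !mxE !(hornerE, horner_exp) /=.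
by rewrite rmorphM !rmorphXn rmorphB rmorph1 rmorphM.
Qed.

Lemma Gbar_polyP (R : idomainType) (N : nat) (beta : R) (l : intpart N) :
  tofrac (Gbar_poly beta l) =
  Gbar_ratio (tofrac (mcst N beta)) l (fun i => tofrac (mvar R i)).
Proof.
apply: (@xgetPex _ _ [set p : mpol R N | tofrac p = _]).
have [p Hp] := vdm_dvd_det
  (fun j => 'X^(part l j) * ('X - (mcst N beta)%:P) ^+ (N - j.+1))
  (fun i => mvar R i).
exists p; rewrite /= /Gbar_ratio tofrac_vdm.
apply: (canRL (mulfK _)); first by rewrite tofrac_eq0 vdm_mvar_neq0.
rewrite -rmorphM -Hp -det_map_mx; congr (\det _).
apply/matrixP => i j; rewrite !mxE !(hornerE, horner_exp) /=.
rewrite rmorphM !rmorphXn rmorphB exprD -mulrA -exprMn mulrBr mulr1 mulrCA divff ?mulr1 //.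
rewrite tofrac_eq0; apply/eqP => /(congr1 (mpoly.mcoeff (mpoly.mnm1 i))).
by rewrite mpoly.mcoeffX eqxx mpoly.mcoeff0 => /eqP; rewrite oner_eq0.
Qed.

(* Main.v *)
Require Import Defs.
From HB Require Import structures.
From mathcomp Require Import all_boot all_order all_algebra.
From mathcomp Require Import -(notations) mpoly.
From mathcomp Require Import boolp classical_sets reals ereal measure.
From mathcomp Require Import topology normedtype sequences.
From mathcomp Require Import interval_inference complex.
From mathcomp Require Import ring lra zify.
Set Implicit Arguments.
Unset Strict Implicit.
Unset Printing Implicit Defensive.
Import Order.TTheory GRing.Theory Num.Theory.
Import numFieldNormedType.Exports.
Local Open Scope ring_scope.

(* Take N = 2, x = (1/2, 1/2), y = (1, 1) and beta = 1. Then Gbar = 1 and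
   Prob(b + d, b) = 2^-(2 b + d) (d + 2) / 8, so that b and d are independent,
     rho(a) = (3 + 2 a 2^a) / 4^(a+1),   rho(a, c) = 2^-(a+c) (c - a + 1) / 4
   for a < c, and the higher correlation functions vanish. Suppose that they are
   the principal minors of K, and let k a c := 4^(a+1) K a c. The minors of sizes
   1 and 2 give the products k a c * k c a, and those of size 3 then give the sums
   T_abc + T_acb, where T_abc := k a b * k b c * k c a. Hence each T_abc is a root
   of a known quadratic equation. On the sites 0, 1, 2, 4 the four triples are
   linked by T_012 T_024 T_041 T_142 = \prod_(a < c) (k a c * k c a), and no
   choice of the roots satisfies this identity. *)

(** * [G] and [Gbar] for [N = 2] at coinciding variables, where the ratio reads 0/0 *)

Lemma meval_diag_antisym_quotient (R : idomainType) (f g : {poly R}) (p : mpol R 2)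
    (c : R) :
  let at_ (h : {poly R}) i := (map_poly (mpolyC 2 (R := R)) h).[mvar R i] in
  p * (mvar R ord0 - mvar R ord_max)
    = at_ f ord0 * at_ g ord_max - at_ f ord_max * at_ g ord0 ->
  mev (fun=> c) p = f^`().[c] * g.[c] - f.[c] * g^`().[c].
Proof.
move=> at_ Hp.
(* Under X_0 |-> 'X, X_1 |-> c the hypothesis becomes p('X, c) * ('X - c) = ...,
   whose derivative at c is the claim. *)
pose v (i : 'I_2) : {poly R} := if i == ord0 then 'X else c%:P.
pose phi : {rmorphism mpol R 2 -> {poly R}} := mmap polyC v.
have phi_at h i : phi (at_ h i) = if i == ord0 then h else h.[c]%:P.
  rewrite /at_ -horner_map -map_poly_comp /= mmapX mmap1U.
  have -> : map_poly (mmap polyC v \o mpolyC 2 (R := R)) h = map_poly polyC h.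
    by apply: eq_map_poly => a /=; rewrite mmapC.
  by rewrite /v; case: ifP => _; [exact: comp_polyXr | rewrite horner_map].
have phiE (q : mpol R 2) : (phi q).[c] = mev (fun=> c) q.
  rewrite /= /mmap mevalE horner_sum; apply: eq_bigr => m _.
  rewrite hornerM hornerC /mmap1 horner_prod; congr (_ * _).
  by apply: eq_bigr => i _; rewrite horner_exp /v; case: ifP; rewrite ?hornerX ?hornerC.
have := congr1 (fun q => (phi q)^`().[c]) Hp.
rewrite /= rmorphM !rmorphB !rmorphM !phi_at /= !mmapX !mmap1U /v /=.
rewrite derivM !derivB !derivM !derivC derivX !(hornerE, phiE) /=.
by rewrite subrr mulr0 add0r subr0 mulr1.
Qed.

Lemma vdm2 (A : comNzRingType) (x : 'I_2 -> A) : vdm x = x ord0 - x ord_max.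
Proof.
rewrite /vdm; under eq_bigr do rewrite big_mkcond.
rewrite !(big_ord_recl, big_ord0) /= !mul1r !mulr1; congr (_ - x _); exact: val_inj.
Qed.

Lemma det2 (A : comNzRingType) (m : 'I_2 -> 'I_2 -> A) :
  \det (\matrix_(i, j) m i j)
    = m ord0 ord0 * m ord_max ord_max - m ord0 ord_max * m ord_max ord0.
Proof.
rewrite (expand_det_row _ ord0) !(big_ord_recl, big_ord0) /cofactor !det_mx11 !mxE /=.
have -> : lift (lift ord0 ord0) 0 = ord0 :> 'I_2 by exact: val_inj.
have -> : lift ord0 0 = ord_max :> 'I_2 by exact: val_inj.
ring.
Qed.

(** The determinant has columns f = ['X^(a.+1)] and g = ['X^b * (1 - beta%:P * 'X)], so the value is
    the Wronskian f' g - f g' at [c]. *)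
Lemma G2_diag (R : idomainType) (beta c : R) (l : intpart 2) :
  let a := part l ord0 in let b := part l ord_max in
  G beta l (fun=> c)
    = c ^+ (a + b) * ((a%:R - b%:R + 1) * (1 - beta * c) + beta * c).
Proof.
move=> a b; rewrite /G.
rewrite (@meval_diag_antisym_quotient _ 'X^(a.+1) ('X^b * (1 - beta%:P * 'X))).
  rewrite !(derivM, derivB, derivX, derivC, derivXn) !hornerE /=.
  rewrite !hornerMn !hornerXn -[_ *+ a.+1]mulr_natr -[_ *+ b]mulr_natr -natr1 exprS.
  (* The derivative of ['X^b] has exponent [b.-1], which is truncated at [b = 0]; there its
     coefficient vanishes. *)
  case: (b) => [|b'] /=.
    rewrite addn0 !expr0; move: (c ^+ a) (a%:R) => x y; ring.
  rewrite -natr1 addnS !exprS exprD.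
  move: (c ^+ a) (a%:R) (c ^+ b') (b'%:R) => x y z t; ring.
apply/eqP; rewrite -tofrac_eq tofracM tofracB G_polyP /G_ratio vdm2 divfK.
  rewrite det2 /= /particle -/a -/b !addn0 addn1.
  rewrite [map_poly _ (_ * _)]rmorphM /= [map_poly _ (_ - _)]rmorphB /= rmorph1.
  rewrite [map_poly _ (_ * _)]rmorphM /= map_polyC map_polyX !map_polyXn.
  rewrite !(hornerM, hornerD, hornerN, hornerC, hornerX, hornerXn) /=.
  rewrite !(tofracB, tofracM, tofracXn, tofrac1).
  by rewrite !expr0 !expr1 !mulr1 [X in _ == _ - X]mulrC.
by rewrite -tofracB tofrac_eq0 -(vdm2 (fun i => mvar R i)) vdm_mvar_neq0.
Qed.

(** The first column contains the factor ['X - beta%:P], so at [beta] only the Wronskian term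
    differentiating this factor survives. This motivates the choice [y = beta]. *)
Lemma Gbar2_diag (R : idomainType) (beta : R) (l : intpart 2) :
  Gbar beta l (fun=> beta) = beta ^+ (part l ord0 + part l ord_max).
Proof.
set a := part l ord0; set b := part l ord_max; rewrite /Gbar.
rewrite (@meval_diag_antisym_quotient _ ('X^a * ('X - beta%:P)) 'X^b).
  rewrite !(derivM, derivB, derivX, derivC, derivXn) !hornerE /= exprD.
  by rewrite subrr !mulr0 mul0r add0r !subr0 mulr1.
apply/eqP; rewrite -tofrac_eq tofracM tofracB Gbar_polyP /Gbar_ratio vdm2 divfK.
  rewrite det2 /= /particle -/a -/b !addn0 addn1.
  rewrite [map_poly _ (_ * _)]rmorphM /= [map_poly _ (_ - _)]rmorphB /=.
  rewrite map_polyC map_polyX !map_polyXn.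
  rewrite !(hornerM, hornerD, hornerN, hornerC, hornerX, hornerXn) /=.
  rewrite !(tofracB, tofracM, tofracXn).
  have mvarK i : tofrac (mvar R i) ^+ a.+1 * (1 - tofrac (mcst 2 beta) / tofrac (mvar R i))
      = tofrac (mvar R i) ^+ a * (tofrac (mvar R i) - tofrac (mcst 2 beta)).
    rewrite exprSr -mulrA mulrBr mulr1 mulrCA divff ?mulr1 // tofrac_eq0.
    by apply/eqP => /(congr1 (mcoeff (mnm1 i))) /eqP; rewrite mcoeffX eqxx mcoeff0 oner_eq0.
  by rewrite !expr0 !expr1 !mulr1 !mvarK [X in _ == _ - X]mulrC.
by rewrite -tofracB tofrac_eq0 -(vdm2 (fun i => mvar R i)) vdm_mvar_neq0.
Qed.

(** * Cyclic products in 3x3 minors and their inconsistency on four sites *)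

(** Permutations are grouped by cycle type: besides the sum of the two 3-cycles, only diagonal
    entries and products of opposite entries occur. *)
Lemma det3 (A : comNzRingType) (m : 'I_3 -> 'I_3 -> A) :
  let i0 : 'I_3 := ord0 in let i1 : 'I_3 := inord 1 in let i2 : 'I_3 := ord_max in
  \det (\matrix_(i, j) m i j)
    = m i0 i0 * m i1 i1 * m i2 i2 + (m i0 i1 * m i1 i2 * m i2 i0 + m i0 i2 * m i2 i1 * m i1 i0)
      - m i0 i0 * (m i1 i2 * m i2 i1) - m i1 i1 * (m i0 i2 * m i2 i0)
      - m i2 i2 * (m i0 i1 * m i1 i0).
Proof.
move=> i0 i1 i2.
have sub j : row' ord0 (col' j (\matrix_(i, j) m i j))
    = \matrix_(k < 2, l < 2) m (lift ord0 k) (lift j l).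
  by apply/matrixP => k l; rewrite !mxE.
rewrite (expand_det_row _ ord0) !(big_ord_recl, big_ord0) /cofactor !sub !det2 !mxE /=.
have e1 : lift ord0 (ord0 : 'I_2) = i1 by apply: val_inj; rewrite /= inordK.
have e2 : lift ord0 (ord_max : 'I_2) = i2 by apply: val_inj.
have e3 : lift i1 (ord0 : 'I_2) = i0 by apply: val_inj; rewrite /= inordK.
have e4 : lift i1 (ord_max : 'I_2) = i2 by apply: val_inj; rewrite /= inordK.
have e5 : lift i2 (ord0 : 'I_2) = i0 by apply: val_inj.
have e6 : lift i2 (ord_max : 'I_2) = i1 by apply: val_inj; rewrite /= inordK.
have e7 : lift ord0 (lift ord0 (ord0 : 'I_1)) = i2 by apply: val_inj.
rewrite !(e1, e2, e7) !(e3, e4, e5, e6) -/i0 /bump /= !addn0 !add0n.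
ring.
Qed.

Lemma cyclic_products_inconsistent (F : numFieldType)
    (k01 k10 k02 k20 k04 k40 k12 k21 k14 k41 k24 k42 : F) :
  k01 * k10 = 5 -> k02 * k20 = 9 -> k04 * k40 = 73 ->
  k12 * k21 = 69 -> k14 * k41 = 405 -> k24 * k42 = 1721 ->
  k01 * k12 * k20 + k02 * k21 * k10 = - 34 ->
  k01 * k14 * k40 + k04 * k41 * k10 = - 370 ->
  k02 * k24 * k40 + k04 * k42 * k20 = 262 ->
  k12 * k24 * k41 + k14 * k42 * k21 = 18 * 631 -> False.
Proof.
move=> h01 h02 h04 h12 h14 h24 t012 t014 t024 t124.
(* Half differences of the two roots of each quadratic equation, divided by
   integers which make their squares square-free. *)
pose p := (k01 * k12 * k20 + 17) / 16.
pose q := (k02 * k24 * k40 - 131) / 8.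
pose r := (k01 * k14 * k40 + 185) / 40.
have Ep : k01 * k12 * k20 = 16 * p - 17 by rewrite /p; field.
have Eq : k02 * k24 * k40 = 8 * q + 131 by rewrite /q; field.
have Er : k01 * k14 * k40 = 40 * r - 185 by rewrite /r; field.
have Ep' : k02 * k21 * k10 = - 16 * p - 17.
  by apply: (addrI (k01 * k12 * k20)); rewrite t012 Ep; ring.
have Eq' : k04 * k42 * k20 = - 8 * q + 131.
  by apply: (addrI (k02 * k24 * k40)); rewrite t024 Eq; ring.
have Er' : k04 * k41 * k10 = - 40 * r - 185.
  by apply: (addrI (k01 * k14 * k40)); rewrite t014 Er; ring.
have nz (n : nat) : (0 < n)%N -> n%:R != 0 :> F by rewrite pnatr_eq0 lt0n.
(* The product of the two roots is the product of the three known pair products; the square of half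
   the difference is the square of half the sum minus this product. *)
have p2 : p ^+ 2 = - 11.
  apply: (mulfI (nz 256%N isT)).
  transitivity (289 - (16 * p - 17) * (- 16 * p - 17)); first by ring.
  rewrite -Ep -Ep'.
  transitivity (289 - (k01 * k10) * (k12 * k21) * (k02 * k20)); first by ring.
  by rewrite h01 h12 h02; ring.
have q2 : q ^+ 2 = - (127 * 137).
  apply: (mulfI (nz 64%N isT)).
  transitivity (131 ^+ 2 - (8 * q + 131) * (- 8 * q + 131)); first by ring.
  rewrite -Eq -Eq'.
  transitivity (131 ^+ 2 - (k02 * k20) * (k24 * k42) * (k04 * k40)); first by ring.
  by rewrite h02 h24 h04; ring.
have r2 : r ^+ 2 = - 71.
  apply: (mulfI (nz 1600%N isT)).
  transitivity (185 ^+ 2 - (40 * r - 185) * (- 40 * r - 185)); first by ring.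
  rewrite -Er -Er'.
  transitivity (185 ^+ 2 - (k01 * k10) * (k14 * k41) * (k04 * k40)); first by ring.
  by rewrite h01 h14 h04; ring.
have rel : r * (17 * q - 262 * p) = (57 * 1000 + 11) + 74 * (p * q).
  (* T_012 T_024 T_041 equals T_124 times the pair products at site 0. Adding the identity for the
     reversed cycles leaves only the known sum T_124 + T_142; 640 is a common factor of the
     result. *)
  apply: (mulfI (nz 640%N isT)).
  have : (16 * p - 17) * (8 * q + 131) * (- 40 * r - 185)
         + (- 16 * p - 17) * (- 8 * q + 131) * (40 * r - 185)
         = (k01 * k10) * (k02 * k20) * (k04 * k40)
           * (k12 * k24 * k41 + k14 * k42 * k21).
    by rewrite -Ep -Eq -Er' -Ep' -Eq' -Er; ring.
  rewrite h01 h02 h04 t124 => /eqP; rewrite -subr_eq0 => /eqP E.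
  apply/eqP; rewrite -subr_eq0 -{}[X in _ == X]E; apply/eqP; ring.
(* Squaring eliminates r^2 and leaves p * q rational, but 11 * 127 * 137 is not a square. *)
have {}rel : 11 * (p * q) = - 5479.
  have: ((57 * 1000 + 11) + 74 * (p * q)) ^+ 2 = (r * (17 * q - 262 * p)) ^+ 2
    by rewrite rel.
  have -> : ((57 * 1000 + 11) + 74 * (p * q)) ^+ 2
            = (57 * 1000 + 11) ^+ 2 + 2 * (57 * 1000 + 11) * 74 * (p * q)
              + 74 ^+ 2 * p ^+ 2 * q ^+ 2 by ring.
  have -> : (r * (17 * q - 262 * p)) ^+ 2
     = r ^+ 2 * (17 ^+ 2 * q ^+ 2 + 262 ^+ 2 * p ^+ 2 - 2 * 17 * 262 * (p * q)) by ring.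
  rewrite p2 q2 r2 => /eqP; rewrite -subr_eq0 => /eqP E.
  (* Common factor of the resulting linear equation in [p * q]. *)
  apply: (mulfI (mulf_neq0 (nz 1944%N isT) (nz 365%N isT))).
  by apply/eqP; rewrite -subr_eq0 -{}[X in _ == X]E; apply/eqP; ring.
have : 121 * (p ^+ 2 * q ^+ 2) = (- 5479) ^+ 2 :> F by rewrite -rel; ring.
rewrite p2 q2 => /eqP; rewrite -subr_eq0.
have -> : 121 * (- 11 * - (127 * 137)) - (- 5479) ^+ 2 = - (2058 * 3334) :> F by ring.
by rewrite oppr_eq0 mulf_eq0 !(negPf (nz _ _)).
Qed.

(** * Vanishing correlations, series, and the two factor laws *)

Local Open Scope classical_set_scope.

(** Choosing a particle for each site would inject ['I_m] into ['I_N]. *)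
Lemma corr_oversized (R : realType) (N : nat) (P : probability (intpart N) R) m
   (a : 'I_m -> nat) : (N < m)%N -> injective a -> corr P a = 0.
Proof.
move=> Nm inja; rewrite /corr (_ : mkset _ = set0) ?measure0 //.
apply/seteqP; split=> // l /= /choice[f fP].
have injf : injective f by move=> i j fij; apply: inja; rewrite -!fP fij.
by have := leq_card f injf; rewrite !card_ord leqNgt Nm.
Qed.

Section Series.
Variable R : realType.

Lemma eseries_finite (f : nat -> \bar R) (n : nat) :
  (forall i, (n <= i)%N -> f i = 0%E) ->
  (\sum_(0 <= i <oo) f i = \sum_(0 <= i < n) f i)%E.
Proof.
move=> f0; apply: lim_near_cst => //; exists n => // m /= nm.
rewrite (big_cat_nat (leq0n n) nm) /= [X in (_ + X)%E]big1_seq ?adde0 // => i.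
by rewrite mem_index_iota => /andP[_ /andP[ni _]]; exact: f0.
Qed.

Lemma eseries_single (f : nat -> \bar R) (k : nat) :
  (forall i, i != k -> f i = 0%E) -> (\sum_(0 <= i <oo) f i = f k)%E.
Proof.
move=> f0; rewrite (@eseries_finite _ k.+1) => [|i ki]; last first.
  by apply: f0; rewrite gtn_eqF.
rewrite big_nat_recr //= big1_seq ?add0e // => i.
by rewrite mem_index_iota => /andP[_ /andP[_ ik]]; rewrite f0 ?ltn_eqF.
Qed.

Lemma eseries_telescope (f c : nat -> R) :
  (forall n, f n = c n - c n.+1) -> (c @ \oo --> 0) ->
  (\sum_(0 <= i <oo) (f i)%:E = (c 0%N)%:E)%E.
Proof.
move=> fc c0; apply/cvg_lim => //.
rewrite (_ : (fun n => _) = (fun n => (c 0%N - c n)%:E)).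
  apply: cvg_EFin; first by near=> n.
  by rewrite -[X in _ --> X]subr0; apply: cvgB => //; exact: cvg_cst.
apply/funext => n; rewrite sumEFin; congr EFin.
by under eq_bigr do rewrite fc -opprB; rewrite sumrN telescope_sumr // opprB.
Unshelve. all: by end_near. Qed.

(** The weight 2^-(2 b + d) (d + 2) / 8 of the partition (b + d, b) splits into these two normalised
    factors, the laws of the smaller part and of the gap. *)
Definition low_law (b : nat) : R := 3 / 4 * (1 / 4) ^+ b.
Definition gap_law (d : nat) : R := (d%:R + 2) / 6 * (1 / 2) ^+ d.

Lemma low_law_ge0 b : 0 <= low_law b.
Proof. by rewrite /low_law mulr_ge0 // exprn_ge0. Qed.

Lemma gap_law_ge0 d : 0 <= gap_law d.
Proof. by rewrite /gap_law mulr_ge0 ?exprn_ge0 // divr_ge0 ?addr_ge0. Qed.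

Lemma sum_low_law : (\sum_(0 <= b <oo) (low_law b)%:E = 1)%E.
Proof.
rewrite (@eseries_telescope _ (fun n => (1 / 4) ^+ n)) // => [n|].
  by rewrite /low_law exprS; field.
by apply: cvg_expr; rewrite ger0_norm //; lra.
Qed.

Lemma sum_gap_law : (\sum_(0 <= d <oo) (gap_law d)%:E = 1)%E.
Proof.
(* [c n] is the tail of the series from [n] on. *)
pose c n : R := (n%:R + 3) / 3 * (1 / 2) ^+ n.
rewrite (@eseries_telescope _ c) => [|n|].
- by rewrite /c expr0 add0r mulr1 divff.
- by rewrite /gap_law /c exprS -natr1; field.
(* The ratio of consecutive tails is (n + 4) / (2 (n + 3)), at most 2/3. *)
have cn n : 0 <= c n <= (2 / 3) ^+ n.
  elim: n => [|n /andP[c0 IH]]; first by rewrite /c !expr0; lra.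
  rewrite exprS -/(c n) in IH *.
  apply/andP; split; first by rewrite /c mulr_ge0 ?exprn_ge0 // divr_ge0 ?addr_ge0.
  apply: (le_trans _ (ler_wpM2l _ IH)) => //; rewrite /c exprS -natr1.
  have : 0 <= (1 / 2 : R) ^+ n by rewrite exprn_ge0.
  have : 0 <= n%:R :> R by [].
  move: (n%:R) (_ ^+ n) => x y x0 y0; nra.
apply: (squeeze_cvgr _ (cvg_cst 0)); first by near=> n; exact: cn.
by apply: cvg_expr; rewrite ger0_norm //; lra.
Unshelve. all: by end_near. Qed.
End Series.

(** * Two-part partitions, parametrised by smaller part and gap *)

Lemma lam_subproof (b d : nat) : sorted geq [tuple (b + d)%N; b].
Proof. by rewrite /= leq_addr. Qed.

Definition lam (b d : nat) : intpart 2 :=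
  exist _ [tuple (b + d)%N; b] (lam_subproof b d).

Lemma part_lam0 b d : part (lam b d) ord0 = (b + d)%N.
Proof. by []. Qed.

Lemma part_lam1 b d : part (lam b d) ord_max = b.
Proof. by []. Qed.

Lemma ord2P (i : 'I_2) : i = ord0 \/ i = ord_max.
Proof. by case: i => [[|[|//]]] ?; [left|right]; exact: val_inj. Qed.

Lemma particle_lam b d (a : nat) :
  (exists i, particle (lam b d) i = a) <-> a = b \/ a = (b + d).+1.
Proof.
have p0 : particle (lam b d) ord0 = (b + d).+1 by rewrite /particle part_lam0 addn1.
have p1 : particle (lam b d) ord_max = b by rewrite /particle part_lam1 addn0.
split=> [[i <-]|[->|->]]; last 2 first.
- by exists ord_max.
- by exists ord0.
by have [->|->] := ord2P i; [right|left].
Qed.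

Lemma lam_surj (l : intpart 2) :
  l = lam (part l ord_max) (part l ord0 - part l ord_max).
Proof.
have le10 : (part l ord_max <= part l ord0)%N.
  case: l => -[[|x [|y [|]]] //= s] srt; rewrite /part !(tnth_nth 0%N) /=.
  by move: srt; rewrite /= andbT.
apply: val_inj; apply: eq_from_tnth => i.
have [->|->] := ord2P i;
  by rewrite -/(part _ _) -/(part _ _) ?part_lam0 ?part_lam1 ?subnKC.
Qed.

Lemma lam_inj b d b' d' : lam b d = lam b' d' -> b = b' /\ d = d'.
Proof.
move=> E; have := congr1 (fun l => part l ord0) E.
have := congr1 (fun l => part l ord_max) E.
by rewrite !part_lam0 !part_lam1 => -> /addnI.
Qed.

(** * The measure, its correlation functions, and the contradiction *)

Section Measure.
Variable R : realType.

(** As mixtures of Dirac masses, this and the next measure inherit countable additivity from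
    [mseries] and [mscale]. *)
Definition gap_measure (b : nat) :=
  mseries (fun d => mscale (NngNum (gap_law_ge0 R d)) (dirac (lam b d))) 0.

Definition grothendieck_half :=
  mseries (fun b => mscale (NngNum (low_law_ge0 R b)) (gap_measure b)) 0.

Lemma gap_measureE b A :
  gap_measure b A = (\sum_(0 <= d <oo) (gap_law R d)%:E * (lam b d \in A)%:R%:E)%E.
Proof. by apply: eq_eseriesr => d _; rewrite -diracE. Qed.

Lemma grothendieck_halfE A : grothendieck_half A =
  (\sum_(0 <= b <oo) (low_law R b)%:E * gap_measure b A)%E.
Proof. by []. Qed.

Lemma gap_measure0 b A : (forall d, ~ A (lam b d)) -> gap_measure b A = 0%E.
Proof.
move=> NA; rewrite gap_measureE; apply: eseries0 => d _ _.
by rewrite memNset ?mule0.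
Qed.

Lemma gap_measure1 b A k : (forall d, A (lam b d) <-> d = k) ->
  gap_measure b A = (gap_law R k)%:E.
Proof.
move=> NA; rewrite gap_measureE (@eseries_single _ _ k) => [|i /eqP ik].
  by rewrite mem_set ?mule1 //; apply/NA.
by rewrite memNset ?mule0 // => /NA.
Qed.

Lemma gap_measureT b A : (forall d, A (lam b d)) -> gap_measure b A = 1%E.
Proof.
move=> TA; rewrite gap_measureE -(sum_gap_law R); apply: eq_eseriesr => d _.
by rewrite mem_set ?mule1.
Qed.

Lemma grothendieck_half_setT : grothendieck_half setT = 1%E.
Proof.
rewrite grothendieck_halfE -(sum_low_law R); apply: eq_eseriesr => b _.
by rewrite gap_measureT ?mule1.
Qed.

HB.instance Definition _ := Measure.on grothendieck_half.
HB.instance Definition _ :=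
  Measure_isProbability.Build _ _ _ grothendieck_half grothendieck_half_setT.

Lemma grothendieck_half1 b d A : (forall b' d', A (lam b' d') <-> b' = b /\ d' = d) ->
  grothendieck_half A = (low_law R b * gap_law R d)%:E.
Proof.
move=> EA; rewrite grothendieck_halfE (@eseries_single _ _ b) => [|i /eqP ib].
  by rewrite (@gap_measure1 _ _ d) // => d'; rewrite EA; split=> [[]|].
by rewrite gap_measure0 ?mule0 // => d' /EA[].
Qed.

(** Here Z' = (1/2)^2 (1/2)^-4 = 4, G = 2^-(2 b + d) (d + 2) / 2 and Gbar = 1. *)
Lemma is_Grothendieck_half :
  is_Grothendieck_measure (fun=> 1 / 2) (fun=> 1) 1
  grothendieck_half.
Proof.
move=> l; rewrite [LHS](@grothendieck_half1 (part l ord_max)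
    (part l ord0 - part l ord_max)).
  rewrite [in RHS](lam_surj l).
  move: (part l ord_max) (part l ord0 - part l ord_max)%N => b d.
  rewrite /Gweight /Gnorm G2_diag Gbar2_diag part_lam0 part_lam1 expr1n mulr1.
  rewrite !(big_ord_recl, big_ord0) /low_law /gap_law natrD !exprD.
  have -> : (1 / 4 : R) ^+ b = (1 / 2) ^+ b * (1 / 2) ^+ b.
    by rewrite -exprMn; congr (_ ^+ _); field.
  by congr EFin; field.
move=> b d; split=> [|[-> ->]]; last by rewrite -lam_surj.
by rewrite {1}(lam_surj l) => /lam_inj.
Qed.

(** Either the upper particle sits at [x], with the lower one at some [b < x], or the lower one sits
    at [x] and the gap is arbitrary. *)
Lemma corr1 x : corr grothendieck_half (fun _ : 'I_1 => x) =
   \sum_(0 <= b < x) low_law R b * gap_law R (x - b).-1 + low_law R x.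
Proof.
rewrite /corr; set A := mkset _.
have AE b d : A (lam b d) <-> x = b \/ x = (b + d).+1.
  rewrite -particle_lam; split=> [/(_ ord0) //|ex _ //].
rewrite [X in fine X]grothendieck_halfE (@eseries_finite _ _ x.+1); last first.
  move=> b xb; rewrite gap_measure0 ?mule0 // => d /AE[]; lia.
rewrite big_nat_recr //= gap_measureT ?mule1 => [|d]; last by apply/AE; left.
rewrite (eq_big_nat _ _ (F2 := fun b => (low_law R b * gap_law R (x - b).-1)%:E)).
  by rewrite sumEFin.
move=> b /andP[_ bx]; rewrite (@gap_measure1 _ _ (x - b).-1) // => d.
rewrite AE; lia.
Qed.

Lemma corr2 x d :
  corr grothendieck_half (tnth [tuple x; (x + d).+1]) = low_law R x * gap_law R d.
Proof.
rewrite /corr [X in fine X](@grothendieck_half1 x d) // => b' d' /=.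
have -> : (forall k, exists i, particle (lam b' d') i = tnth [tuple x; (x + d).+1] k)
  <-> (x = b' \/ x = (b' + d').+1) /\ ((x + d).+1 = b' \/ (x + d).+1 = (b' + d').+1).
  rewrite -!particle_lam; split=> [H|[H0 H1] k].
    by split; [exact: (H ord0) | exact: (H ord_max)].
  by have [->|->] := ord2P k.
lia.
Qed.

Lemma not_determinantal : ~ determinantal (@corr R 2 grothendieck_half).
Proof.
case=> K HK.
(* This row scaling turns the minors used below into integers. *)
pose k x y : R[i] := 4 ^+ x.+1 * K x y.
have pow4C n z : ((4 ^+ n * z)%:C)%C = 4 ^+ n * (z%:C)%C :> R[i].
  by rewrite rmorphM rmorphXn rmorph_nat.
have k1 x : k x x
    = (4 ^+ x.+1 * corr grothendieck_half (fun _ : 'I_1 => x))%:C%C.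
  rewrite pow4C HK //; last by move=> i j _; rewrite !ord1.
  by rewrite det_mx11 mxE.
have k2 x d (y := (x + d).+1) : k x x * k y y - k x y * k y x
    = (4 ^+ x.+1 * (4 ^+ y.+1 * corr grothendieck_half (tnth [tuple x; y])))%:C%C.
  rewrite !pow4C HK //; last by apply/tuple_uniqP; rewrite /= inE /y; lia.
  rewrite det2 !(tnth_nth 0%N) /= /k -/y; ring.
(* With only two particles the three-point minor vanishes, which determines the sum of the two
   3-cycles. *)
have k3 x y z : x != y -> x != z -> y != z ->
    k x y * k y z * k z x + k x z * k z y * k y x
    = k x x * (k y z * k z y) + k y y * (k x z * k z x) + k z z * (k x y * k y x)
      - k x x * k y y * k z z.
  move=> xy xz yz.
  have tinj : injective (tnth [tuple x; y; z]).
    by apply/tuple_uniqP; rewrite /= !inE negb_or xy xz yz.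
  have := HK 3%N _ isT tinj.
  rewrite corr_oversized //.
  rewrite det3 !(tnth_nth 0%N) /= inordK //= rmorph0 => /esym D.
  apply/eqP; rewrite -subr_eq0 -(mulr0 (4 ^+ x.+1 * 4 ^+ y.+1 * 4 ^+ z.+1)) -D /k.
  by apply/eqP; ring.
have natC z (n : nat) : z = n%:R -> (z%:C)%C = n%:R :> R[i].
  by move=> ->; rewrite rmorph_nat.
have d0 : k 0%N 0%N = 3.
  rewrite k1; apply: (natC _ 3%N); rewrite corr1 /low_law /gap_law.
  by rewrite unlock /=; field.
have d1 : k 1%N 1%N = 7.
  rewrite k1; apply: (natC _ 7%N); rewrite corr1 /low_law /gap_law.
  by rewrite unlock /=; field.
have d2 : k 2%N 2%N = 19.
  rewrite k1; apply: (natC _ 19%N); rewrite corr1 /low_law /gap_law.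
  by rewrite unlock /=; field.
have d4 : k 4%N 4%N = 131.
  rewrite k1; apply: (natC _ 131%N); rewrite corr1 /low_law /gap_law.
  by rewrite unlock /=; field.
have k2n x y (n : nat) : (x < y)%N ->
   4 ^+ x.+1 * (4 ^+ y.+1 * (low_law R x * gap_law R (y - x).-1)) = n%:R ->
   k x y * k y x = k x x * k y y - n%:R.
  move=> xy E; have := k2 x (y - x).-1; rewrite /= corr2.
  have -> : (x + (y - x).-1).+1 = y by lia.
  rewrite (natC _ _ E) => <-; ring.
(* In these six cases the integer [n] is the scaled two-point function 2^(x + y + 2) (y - x + 1). *)
have e01 : k 0%N 1%N * k 1%N 0%N = 5.
  by rewrite (@k2n 0%N 1%N 16%N) ?d0 ?d1 // /low_law /gap_law /=; field.
have e02 : k 0%N 2%N * k 2%N 0%N = 9.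
  by rewrite (@k2n 0%N 2%N 48%N) ?d0 ?d2 // /low_law /gap_law /=; field.
have e04 : k 0%N 4%N * k 4%N 0%N = 73.
  by rewrite (@k2n 0%N 4%N 320%N) ?d0 ?d4 // /low_law /gap_law /=; field.
have e12 : k 1%N 2%N * k 2%N 1%N = 69.
  by rewrite (@k2n 1%N 2%N 64%N) ?d1 ?d2 // /low_law /gap_law /=; field.
have e14 : k 1%N 4%N * k 4%N 1%N = 405.
  by rewrite (@k2n 1%N 4%N 512%N) ?d1 ?d4 // /low_law /gap_law /=; field.
have e24 : k 2%N 4%N * k 4%N 2%N = 1721.
  by rewrite (@k2n 2%N 4%N 768%N) ?d2 ?d4 // /low_law /gap_law /=; field.
apply: (cyclic_products_inconsistent e01 e02 e04 e12 e14 e24).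
- by rewrite k3 // e01 e02 e12 d0 d1 d2; ring.
- by rewrite k3 // e01 e04 e14 d0 d1 d4; ring.
- by rewrite k3 // e02 e04 e24 d0 d2 d4; ring.
- by rewrite k3 // e12 e14 e24 d1 d2 d4; ring.
Qed.

End Measure.

Theorem theorem1p2 (R : realType) :
  exists (N : nat) (x y : 'I_N -> R) (beta : R)
         (P : probability (intpart N) R),
    [/\ (1 <= N)%N,
        (forall i, 0 <= x i) /\ (forall j, 0 <= y j),
        forall i j, x i * y j < 1,
        forall i, (beta%:E <= mine (x i)%:E^-1 (y i)%:E)%E
      & is_Grothendieck_measure x y beta P /\
        ~ determinantal (@corr R N P)].
Proof.
exists 2%N, (fun=> 1 / 2), (fun=> 1), 1, (grothendieck_half R); split => //.
- by move=> _ _ /=; rewrite mulr1; lra.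
(* The bound [beta <= y i] is an equality. The case split is on [x i = 0], where the extended
   inverse is infinite. *)
- by move=> i; rewrite /= le_min inver lexx andbT; case: eqP => _; rewrite ?leey // lee_fin; lra.
- by split; [exact: is_Grothendieck_half | exact: not_determinantal].
Qed.
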